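(* Let $K$ be a compact Hausdorff space which is not scattered. Then at least one of the following holds: there is a nonatomic strongly countably determined measure $\mu\in P(K)$; or there is a measure $\mu\in P(K)$ of uncountable Maharam type.
   Context: A topological space is scattered if every nonempty subset of it has an isolated point (in the subspace topology). For a compact Hausdorff space $K$, a Radon measure on $K$ is a finite Borel measure $\mu$ with $\mu(B)=\sup\{\mu(F): F \text{ closed}, F\subseteq B\}$ for every Borel $B\subseteq K$; $P(K)$ is the set of all Radon probability measures on $K$. A measure $\mu\in P(K)$ is strongly countably determined if there is a continuous map $f:K\to[0,1]^\omega$ such that $\mu(F)=\mu(f^{-1}[f[F]])$ for every compact set $F\subseteq K$. The Maharam type of $\mu\in P(K)$ is the density character of the Banach space $L_1(\mu)$ (the least cardinality of a norm-dense subset). *)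

(* Defs.v *)
From HB Require Import structures.
From mathcomp Require Import all_boot all_order all_algebra.
From mathcomp Require Import all_classical all_reals all_analysis.
Import Order.TTheory GRing.Theory Num.Theory.
Import numFieldNormedType.Exports.

Set Implicit Arguments.
Unset Strict Implicit.
Unset Printing Implicit Defensive.

Local Open Scope classical_set_scope.
Local Open Scope ring_scope.

Definition scattered (K : topologicalType) : Prop :=
  forall A : set K, A !=set0 -> isolated A !=set0.

Notation borel K := (g_sigma_algebraType (@open K)).

(* The library's measurable types are pointed, whence ptopologicalType below:
   this only requires K to be nonempty, as every non-scattered space is. *)
Section measures.
Context (R : realType) (K : ptopologicalType).
Implicit Type mu : probability (borel K) R.
Local Open Scope ereal_scope.

Definition radon mu : Prop :=
  forall B : set (borel K), measurable B ->
    mu B = ereal_sup [set mu F | F in [set F : set K | closed F /\ F `<=` B]].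

Definition nonatomic mu : Prop :=
  forall A : set (borel K), measurable A -> 0 < mu A ->
    exists B : set (borel K),
      [/\ measurable B, B `<=` A, 0 < mu B & mu B < mu A].

Definition hilbert_cube : set {ptws nat -> R} :=
  [set z | forall n : nat, z n \in `[0%R, 1%R]].

(* {ptws nat -> R} carries the product topology, so a continuous map into it
   with range in the cube is a continuous map to the cube. When K is compact
   Hausdorff, f @` F is compact, so both sides are measures of Borel sets. *)
Definition strongly_countably_determined mu : Prop :=
  exists f : K -> {ptws nat -> R},
    [/\ continuous f, range f `<=` hilbert_cube &
        forall F : set K, compact F -> mu F = mu (f @^-1` (f @` F))].

Definition L1_dense mu (D : set (LspaceType1 mu)) : Prop :=
  forall (f : LspaceType1 mu) (e : R), (0 < e)%R ->
    exists2 g, D g & ('N[mu]_1[(fun x => (f x - g x)%R%:E)] < e%:E)%E.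

(* Cardinals are represented by sets up to #= : kappa represents the least
   cardinality of a norm-dense subset of L_1(mu). *)
Definition is_maharam_type mu (U : Type) (kappa : set U) : Prop :=
  (exists2 D : set (LspaceType1 mu), L1_dense D & (D #= kappa)%card) /\
  (forall D : set (LspaceType1 mu), L1_dense D -> (kappa #<= D)%card).

Definition uncountable_maharam_type mu : Prop :=
  exists kappa : set (LspaceType1 mu),
    is_maharam_type mu kappa /\ ~ countable kappa.

End measures.

(* Main.v *)
Require Import Defs.
From HB Require Import structures.
From mathcomp Require Import all_boot all_order all_algebra.
From mathcomp Require Import all_classical all_reals all_analysis.
From mathcomp Require Import measurable_realfun.
From mathcomp Require Import ring lra.
Import Order.TTheory GRing.Theory Num.Theory.
Import numFieldNormedType.Exports.

Set Implicit Arguments.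
Unset Strict Implicit.
Unset Printing Implicit Defensive.

Local Open Scope classical_set_scope.
Local Open Scope ring_scope.

(* Measures are handled as states, the positive normalized functionals on
   continuous functions. For a sequence [g] of continuous functions and a state
   [L], call [(g', L')] larger than [(g, L)] if [g'] determines [g], [L'] agrees
   with [L] on the functions factoring through [g], and these are not dense, in
   the [L_1] seminorm of [L'], among the functions factoring through [g'].
   A Cantor scheme in a nonempty set without isolated points yields a first pair
   whose state is nonatomic, as witnessed by functions factoring through [g];
   this passes to larger pairs. Take a maximal chain above it.
   If countably many pairs are cofinal in the chain, merging their sequences
   gives a pair [(g, L)] with nothing larger. If [F] is compact and [F'] is its
   saturation for [g], then Hahn-Banach gives a state agreeing with [L] on the
   functions factoring through [g] under which a function close to the indicator
   of [F] weighs at least the measure of [F']; averaging with [L], maximality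
   forces the same for [L], so that [F] and [F'] have the same measure.
   Otherwise take a state [L] extending the whole chain. A countable dense subset
   of [L_1] would be approximated, as far as possible, by functions factoring
   through countably many pairs, hence through a single pair of the chain, against
   the non-density built into the next larger one. *)

(** * Hahn-Banach *)

Section functional_of_cone.
Context (R : realType) (V : lmodType R).
Implicit Types (Q M : set (V * R)) (u v : V) (c d r t : R).

(** A system of constraints [L u <= c], closed under the consequences of linearity; the last clause
    is its consistency, as [L 0 = 0]. *)
Definition cone Q : Prop :=
  [/\ Q (0, 0),
      forall u c v d, Q (u, c) -> Q (v, d) -> Q (u + v, c + d),
      forall t u c, 0 <= t -> Q (u, c) -> Q (t *: u, t * c) &
      forall c, Q (0, c) -> 0 <= c].

Lemma maximal_cone Q : cone Q ->
  exists M, [/\ cone M, Q `<=` M &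
    forall v r, ~ M (v, r) -> exists2 c, c < - r & M (- v, c)].
Proof.
move=> Qcone.
(* Zorn's lemma runs over the sets whose union with [Q] is a cone, so that the empty chain also has
   an admissible union. *)
have [F FP Ftot|A [Acone Amax]] :=
  @Zorn_bigcup _ (fun X : set (V * R) => cone (X `|` Q)).
  have pick2 p q : (\bigcup_(X in F) X `|` Q) p -> (\bigcup_(X in F) X `|` Q) q ->
      exists X, [/\ cone (X `|` Q), X `<=` \bigcup_(X in F) X,
                    (X `|` Q) p & (X `|` Q) q].
    have sub X : F X -> X `<=` \bigcup_(X in F) X by move=> FX x Xx; exists X.
    have Q0 : cone (set0 `|` Q) by rewrite set0U.
    move=> [[X FX Xp]|Qp] [[Y FY Yq]|Qq].
    - have [XY|YX] := Ftot _ _ FX FY.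
        by exists Y; split; [exact: FP|exact: sub|left; exact: XY|left].
      by exists X; split; [exact: FP|exact: sub|left|left; exact: YX].
    - by exists X; split; [exact: FP|exact: sub|left|right].
    - by exists Y; split; [exact: FP|exact: sub|right|left].
    - by exists set0; split => //; right.
  have [Q00 _ _ _] := Qcone.
  split => [|u c v d p q|t u c t0 p|c p]; first by right.
  - have [X [[_ XD _ _] XF Xp Xq]] := pick2 _ _ p q.
    by have [/XF ?|?] := XD _ _ _ _ Xp Xq; [left|right].
  - have [X [[_ _ XZ _] XF Xp _]] := pick2 _ _ p p.
    by have [/XF ?|?] := XZ _ _ _ t0 Xp; [left|right].
  - have [X [[_ _ _ X0] _ Xp _]] := pick2 _ _ p p.
    exact: X0.
set M := A `|` Q in Acone.
exists M; split => //; first by move=> ? ?; right.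
move=> v r nM; have [M0 MD MZ Mpos] := Acone.
(* The cone generated by [M] and [(v, r)]. By maximality it is inconsistent: [u + t *: v = 0] with
   [c + t * r < 0]. Consistency of [M] excludes [t = 0], and division by [t] yields the bound on
   [- v]. *)
pose N := [set p | exists u c t, [/\ M (u, c), 0 <= t & p = (u + t *: v, c + t * r)]].
have MN : M `<=` N.
  by move=> [u c] Muc; exists u, c, 0; rewrite scale0r mul0r !addr0.
have AN : A `<` N.
  split; first by move=> p Ap; apply: MN; left.
  move=> NA; apply: nM; left; apply: NA; exists 0, 0, 1.
  by rewrite scale1r mul1r !add0r.
apply: contrapT => noc; apply: (Amax _ AN).
have -> : N `|` Q = N.
  by apply/seteqP; split => [p [//|Qp]|p]; [apply: MN; right|left].
split => [|u c u' c'|t u c t0|c].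
- exact: MN.
- move=> [u1 [c1 [t1 [? ? [-> ->]]]]] [u2 [c2 [t2 [? ? [-> ->]]]]].
  exists (u1 + u2), (c1 + c2), (t1 + t2); split; [exact: MD|exact: addr_ge0|].
  by rewrite scalerDl mulrDl; congr (_, _); exact: addrACA.
- move=> [u1 [c1 [t1 [? ? [-> ->]]]]].
  exists (t *: u1), (t * c1), (t * t1).
  split; [exact: MZ|exact: mulr_ge0|].
  by rewrite scalerDr scalerA mulrDr mulrA.
- move=> [u1 [c1 [t1 [M1 t1ge0 [/esym u1E ->]]]]].
  have [t10|t10] := eqVneq t1 0.
    move: u1E; rewrite t10 scale0r mul0r !addr0 => u10.
    by apply: Mpos; rewrite -u10.
  have {t1ge0 t10} t1gt0 : 0 < t1 by rewrite lt_def t10.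
  rewrite leNgt; apply/negP => lt0; apply: noc; exists (t1^-1 * c1).
    by rewrite -ltr_pdivlMl ?invr_gt0// invrK mulrN -subr_lt0 opprK.
  have -> : - v = t1^-1 *: u1.
    have -> : u1 = - (t1 *: v) by apply/eqP; rewrite -subr_eq0 opprK; exact/eqP.
    by rewrite scalerN scalerA mulVf ?scale1r// gt_eqF.
  by apply: MZ => //; rewrite invr_ge0 ltW.
Qed.

(* Hahn-Banach: the pair [(u, c)] in [Q] stands for the constraint [L u <= c]. *)
Lemma functional_of_cone Q (S : set V) : cone Q ->
  S 0 -> (forall a u v, S u -> S v -> S (a *: u + v)) ->
  (forall u, S u -> exists c, Q (u, c)) ->
  exists L : V -> R,
    (forall a u v, S u -> S v -> L (a *: u + v) = a * L u + L v) /\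
    (forall u c, S u -> Q (u, c) -> L u <= c).
Proof.
move=> /maximal_cone[M [[M0 MD MZ Mpos] QM Mmax]] S0 SL SQ.
have SN u : S u -> S (- u).
  by move=> Su; have := SL (-1) _ _ Su S0; rewrite scaleN1r addr0.
have SD u v : S u -> S v -> S (u + v).
  by move=> Su Sv; have := SL 1 _ _ Su Sv; rewrite scale1r.
have SZ a u : S u -> S (a *: u).
  by move=> Su; have := SL a _ _ Su S0; rewrite addr0.
pose L v := inf [set c | M (v, c)].
have Minf v : S v -> has_inf [set c | M (v, c)].
  move=> Sv; split; first by have [c /QM Mc] := SQ _ Sv; exists c.
  have [d /QM Md] := SQ _ (SN _ Sv).
  exists (- d) => c /= Mc; rewrite -subr_ge0 opprK.
  by apply: Mpos; rewrite -(subrr v); exact: MD.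
have LM v c : S v -> M (v, c) -> L v <= c.
  by move=> /Minf[_ ?] Mc; exact: ge_inf.
have leL v r : S v -> (forall c, M (v, c) -> r <= c) -> r <= L v.
  by move=> /Minf[? _] rle; apply: lb_le_inf.
(* Maximality of [M] makes [L] odd; additivity then follows from subadditivity. *)
have LN v : S v -> L (- v) = - L v.
  move=> Sv; have SNv := SN _ Sv; apply/eqP; rewrite eq_le; apply/andP; split.
    rewrite lerNr; apply/ler_addgt0Pl => e e0.
    have : ~ M (v, L v - e).
      by move=> /(LM _ _ Sv); apply/negP; rewrite -ltNge ltrBlDr ltrDl.
    move=> /Mmax[c cr /(LM _ _ SNv) Lc]; move: cr Lc; lra.
  apply: (@leL) => // c Mc; rewrite lerNl; apply: leL => // d Md.
  rewrite -subr_ge0 opprK; apply: Mpos; rewrite -(subrr v); exact: MD.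
have LDle u v : S u -> S v -> L (u + v) <= L u + L v.
  move=> Su Sv; rewrite -lerBlDr; apply: (@leL) => // c Mc.
  rewrite lerBlDr -lerBlDl; apply: leL => // d Md.
  rewrite lerBlDl; apply: LM; [exact: SD|exact: MD].
have LD u v : S u -> S v -> L (u + v) = L u + L v.
  move=> Su Sv; apply/eqP; rewrite eq_le LDle//=.
  have := LDle _ _ (SN _ Su) (SN _ Sv).
  by rewrite -opprD !LN//; [lra|exact: SD].
have LZle t u : 0 < t -> S u -> t * L u <= L (t *: u).
  move=> t0 Su; apply: leL; first exact: SZ.
  move=> c Mc; rewrite -ler_pdivlMl//; apply: LM => //.
  rewrite -[u]scale1r -(@mulVf _ t) ?gt_eqF// -scalerA.
  by apply: MZ => //; rewrite invr_ge0 ltW.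
have LZp t u : 0 < t -> S u -> L (t *: u) = t * L u.
  move=> t0 Su; apply/eqP; rewrite eq_le LZle// andbT.
  have ti0 : 0 < t^-1 by rewrite invr_gt0.
  have := LZle _ _ ti0 (SZ t _ Su).
  by rewrite scalerA mulVf ?gt_eqF// scale1r ler_pdivrMl.
have L0 : L 0 = 0.
  have := LN _ S0; rewrite oppr0; lra.
exists L; split; last by move=> u c Su /QM; exact: LM.
move=> a u v Su Sv; rewrite LD//; last exact: SZ.
congr (_ + _); have [a0|a0|->] := ltgtP a 0; last by rewrite scale0r mul0r L0.
- have Na0 : 0 < - a by rewrite oppr_gt0.
  have := LZp _ _ Na0 Su; rewrite scaleNr LN//; last exact: SZ.
  by rewrite mulNr => /oppr_inj.
- exact: LZp.
Qed.

End functional_of_cone.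

(** * States and their extension from subspaces *)

Section states.
Context (R : realType) (K : ptopologicalType).
Implicit Types (f g h u v : K -> R) (L : (K -> R) -> R).

Definition state L : Prop :=
  [/\ forall a f g, continuous f -> continuous g ->
        L (a *: f + g) = a * L f + L g,
      forall f, continuous f -> (forall x, 0 <= f x) -> 0 <= L f &
      L (cst 1) = 1].

Lemma ctsZD a f g :
  continuous f -> continuous g -> continuous (a *: f + g).
Proof. by move=> cf cg x; apply: cvgD; [apply: cvgZr; exact: cf|exact: cg]. Qed.

Lemma cts_cst a : continuous (cst a : K -> R).
Proof. by move=> x; exact: cvg_cst. Qed.

Lemma ctsB f g : continuous f -> continuous g -> continuous (f \- g).
Proof. by move=> cf cg x; apply: cvgB; [exact: cf|exact: cg]. Qed.

Lemma ctsD f g : continuous f -> continuous g -> continuous (f \+ g).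
Proof. by move=> cf cg x; apply: cvgD; [exact: cf|exact: cg]. Qed.

Lemma ctsM f g : continuous f -> continuous g -> continuous (f \* g).
Proof. by move=> cf cg x; apply: cvgM; [exact: cf|exact: cg]. Qed.

Lemma cts_max f g : continuous f -> continuous g -> continuous (f \max g).
Proof. by move=> cf cg x; apply: continuous_max; [exact: cf|exact: cg]. Qed.

Lemma cts_min f g : continuous f -> continuous g -> continuous (f \min g).
Proof. by move=> cf cg x; apply: continuous_min; [exact: cf|exact: cg]. Qed.

Lemma cts_abs f : continuous f -> continuous (fun x => `|f x|).
Proof. by move=> cf x; apply: cvg_norm; exact: cf. Qed.

Section state_theory.
Context L (sL : state L).

Lemma stateD f g : continuous f -> continuous g -> L (f \+ g) = L f + L g.
Proof.
move=> cf cg; have [lin _ _] := sL.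
by have := lin 1 f g cf cg; rewrite scale1r mul1r.
Qed.

Lemma state0 : L (cst 0) = 0.
Proof.
have c0 := @cts_cst 0; have := stateD c0 c0.
have -> : (cst 0 : K -> R) \+ cst 0 = cst 0 by apply/funext => x; rewrite /= addr0.
lra.
Qed.

Lemma stateZ a f : continuous f -> L (a *: f) = a * L f.
Proof.
move=> cf; have [lin _ _] := sL.
by have := lin a f _ cf (@cts_cst 0); rewrite state0 !addr0.
Qed.

Lemma stateB f g : continuous f -> continuous g -> L (f \- g) = L f - L g.
Proof.
move=> cf cg; have [lin _ _] := sL.
transitivity (L ((-1) *: g + f)); last by rewrite lin// mulN1r addrC.
by congr L; apply/funext => x; rewrite scaleN1r /= [RHS]addrC.
Qed.

Lemma state_cst a : L (cst a) = a.
Proof.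
have [_ _ L1] := sL; transitivity (L (a *: cst 1)).
  by congr L; apply/funext => x /=; exact/esym/mulr1.
by rewrite stateZ ?L1 ?mulr1//; exact: cts_cst.
Qed.

Lemma state_ge0 f : continuous f -> (forall x, 0 <= f x) -> 0 <= L f.
Proof. by have [_ pos _] := sL; exact: pos. Qed.

Lemma le_state f g : continuous f -> continuous g -> (forall x, f x <= g x) ->
  L f <= L g.
Proof.
move=> cf cg fg; rewrite -subr_ge0 -stateB//; apply: state_ge0 => [|x].
  exact: ctsB.
by rewrite /= subr_ge0.
Qed.

End state_theory.

Lemma continuous_bounded f : compact [set: K] -> continuous f ->
  exists M, forall x, f x <= M.
Proof.
move=> cK cf.
have : compact (f @` setT).
  by apply: continuous_compact => //; exact: continuous_subspaceT.
move=> /compact_bounded[M [_ /(_ (M + 1))]]; rewrite ltrDl ltr01 => /(_ isT) fM.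
by exists (M + 1) => x; rewrite (le_trans (ler_norm _))//; exact: fM.
Qed.

(* [G] is the graph of a positive normalized functional defined on a subspace;
   the condition on [v] and [r] says that [r] does not exceed the largest value
   that an extension may take at [v]. *)
Lemma state_extension (G : set ((K -> R) * R)) v r :
  compact [set: K] -> continuous v ->
  (forall a c, G (a, c) -> continuous a) ->
  (forall s a c b d, G (a, c) -> G (b, d) -> G (s *: a + b, s * c + d)) ->
  G (cst 1, 1) ->
  (forall a c, G (a, c) -> (forall x, 0 <= a x) -> 0 <= c) ->
  (forall a c, G (a, c) -> (forall x, v x <= a x) -> r <= c) ->
  exists L, [/\ state L, forall a c, G (a, c) -> L a = c & r <= L v].
Proof.
move=> cK cv Gc Glin G1 Gpos Gv.
have G0 : G (cst 0, 0).
  have := Glin (-1) _ _ _ _ G1 G1; rewrite mulN1r addNr.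
  by congr (G (_, _)); apply/funext => x; rewrite scaleN1r /= addNr.
have GZ s a c : G (a, c) -> G (s *: a, s * c).
  by move=> Ga; have := Glin s _ _ _ _ Ga G0; rewrite !addr0.
have GD a c b d : G (a, c) -> G (b, d) -> G (a + b, c + d).
  by move=> Ga Gb; have := Glin 1 _ _ _ _ Ga Gb; rewrite scale1r mul1r.
(* The constraints forced by positivity, by [L a = d] on [G] and by [r <= L v]: from [u + t v <= a]
   follows [L u <= d - t r]. *)
pose Q := [set p : (K -> R) * R | exists t a d,
  [/\ 0 <= t, G (a, d), forall x, p.1 x + t * v x <= a x & d <= p.2 + t * r]].
have QG a c : G (a, c) -> Q (a, c).
  by move=> Ga; exists 0, a, c; split=> // [x|]; rewrite /= mul0r addr0.
have [|||f cf|L [Llin LQ]] := @functional_of_cone R _ Q (fun f => continuous f).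
- split.
  + exact: QG.
  + move=> f c g d [t1 [a1 [d1 [? ? ? ?]]]] [t2 [a2 [d2 [? ? ? ?]]]].
    exists (t1 + t2), (a1 + a2), (d1 + d2); split => //=.
    * exact: addr_ge0.
    * exact: GD.
    * move=> x; rewrite mulrDl [leLHS](_ : _ = (f x + t1 * v x) + (g x + t2 * v x)).
        exact: lerD.
      exact: addrACA.
    * by rewrite mulrDl addrACA; exact: lerD.
  + move=> s f c s0 [t [a [d [t0 Ga fa dc]]]].
    exists (s * t), (s *: a), (s * d); split => /=.
    * exact: mulr_ge0.
    * exact: GZ.
    * move=> x; rewrite -mulrA [leLHS](_ : _ = s * (f x + t * v x)).
        exact: ler_wpM2l.
      by rewrite mulrDr.
    * by rewrite -mulrA -mulrDr; exact: ler_wpM2l.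
  (* Consistency: for [t = 0] it is positivity on [G]; for [t > 0] the function [a / t] dominates
     [v], and the hypothesis on [r] applies. *)
  + move=> c [t [a [d [t0 Ga /= fa dc]]]].
    have [t00|t00] := eqVneq t 0.
      rewrite t00 mul0r addr0 in dc; apply: le_trans dc; apply: Gpos Ga _ => x.
      by have := fa x; rewrite t00 mul0r addr0.
    have {t0 t00} tp : 0 < t by rewrite lt_def t00.
    have := Gv _ _ (GZ t^-1 _ _ Ga).
    rewrite ler_pdivlMl// => /(_ _)/le_trans => /(_ _ _ dc).
    rewrite lerDr; apply => x.
    by rewrite ler_pdivlMl//; have := fa x; rewrite add0r.
- exact: cts_cst.
- by move=> ? ? ?; exact: ctsZD.
- have [M fM] := continuous_bounded cK cf.
  exists M, 0, (M *: cst 1), (M * 1).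
  split => [||x|] //=; first exact: GZ.
    by rewrite mul0r addr0; apply: (le_trans (fM x)); rewrite -[leLHS]mulr1.
  by rewrite mulr1 mul0r addr0.
have LN f : continuous f -> L (- f) = - L f.
  move=> cf; have L0 : L (cst 0) = 0.
    have := Llin (-1) _ _ (@cts_cst 0) (@cts_cst 0).
    have -> : (-1) *: cst 0 + cst 0 = cst 0 :> (K -> R).
      by apply/funext => x; rewrite scaleN1r [LHS]addNr.
    lra.
  have := Llin (-1) f (cst 0) cf (@cts_cst 0).
  have -> : (-1) *: f + cst 0 = - f.
    by apply/funext => x; rewrite scaleN1r [LHS]addr0.
  by rewrite L0 addr0 mulN1r.
have cN f : continuous f -> continuous (- f).
  by move=> cf x; apply: cvgN; exact: cf.
have LG a c : G (a, c) -> L a = c.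
  move=> Ga; have ca := Gc _ _ Ga; apply/eqP; rewrite eq_le LQ//=; last exact: QG.
  rewrite -lerN2 -LN//; apply: LQ; first exact: cN.
  by apply: QG; have := GZ (-1) _ _ Ga; rewrite scaleN1r mulN1r.
exists L; split => //.
- split => //; last exact: LG.
  move=> f cf f0; rewrite -oppr_le0 -LN//; apply: LQ; first exact: cN.
  exists 0, (cst 0), 0; split => // [x|]; rewrite /= mul0r addr0//.
  by rewrite oppr_le0.
- rewrite -lerN2 -LN//; apply: LQ; first exact: cN.
  exists 1, (cst 0), 0; split => // [x|]; rewrite mul1r/=.
    by rewrite [leLHS]addNr.
  by rewrite addNr.
Qed.

End states.

(** * Riesz-Markov representation *)

Section riesz.
Context (R : realType) (K : ptopologicalType).
Hypotheses (cK : compact [set: K]) (hK : hausdorff_space K).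
Implicit Types (f g h u v : K -> R) (A B E F U V : set K).

Lemma urysohn_compact A B : closed A -> closed B -> A `&` B = set0 ->
  exists f, [/\ continuous f, forall x, 0 <= f x <= 1,
    forall x, A x -> f x = 0 & forall x, B x -> f x = 1].
Proof.
move=> cA cB AB0.
have /normal_separatorP sep := compact_normal hK cK.
have /(uniform_separatorP (R := R))[f [cf f01 fA fB]] := sep R _ _ cA cB AB0; exists f; split => //.
- by move=> x; have := f01 (f x); rewrite /= in_itv/=; apply; exists x.
- by move=> x Ax; apply: fA; exists x.
- by move=> x Bx; apply: fB; exists x.
Qed.

Lemma cts_closed_ge f c : continuous f -> closed [set x | c <= f x].
Proof.
move=> cf; rewrite (_ : [set x | _] = f @^-1` [set y | c <= y])//.
by apply: closed_comp => [x _|]; [exact: cf|exact: closed_ge].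
Qed.

Lemma cts_open_lt f c : continuous f -> open [set x | f x < c].
Proof.
move=> cf; rewrite (_ : [set x | _] = f @^-1` [set y | y < c])//.
by apply: open_comp => [x _|]; [exact: cf|exact: open_lt].
Qed.

Lemma cts_open_gt f c : continuous f -> open [set x | c < f x].
Proof.
move=> cf; rewrite (_ : [set x | _] = f @^-1` [set y | c < y])//.
by apply: open_comp => [x _|]; [exact: cf|exact: open_gt].
Qed.

Lemma compact_bigcup_ord F (U : nat -> set K) : closed F ->
  (forall n, open (U n)) -> F `<=` \bigcup_n U n ->
  exists N, F `<=` \big[setU/set0]_(i < N) U i.
Proof.
move=> cF oU FU.
have : compact F by apply: (subclosed_compact cF cK).
rewrite compact_cover => /(_ _ setT U (fun i _ => oU i) FU)[D _ FD].
exists (\max_(i <- finmap.enum_fset D) i).+1 => x /FD[i /= iD Uix].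
rewrite -bigcup_mkord; exists i => //=; rewrite ltnS.
exact: (@leq_bigmax_seq _ (finmap.enum_fset D) xpredT id i).
Qed.

Variables (L : (K -> R) -> R) (sL : state L).

(** Vanishing off [U] replaces the usual support inside [U]; the room between the two is regained by
    [shave]. *)
Definition under U h : Prop :=
  [/\ continuous h, forall x, 0 <= h x <= 1 & forall x, ~ U x -> h x = 0].

Definition inner U : \bar R := ereal_sup [set (L h)%:E | h in under U].

Definition outer E : \bar R :=
  ereal_inf [set inner U | U in [set U | open U /\ E `<=` U]].

Lemma inner_ge U h : under U h -> ((L h)%:E <= inner U)%E.
Proof. by move=> Uh; apply: ereal_sup_ubound; exists h. Qed.

Lemma inner_le U c : (forall h, under U h -> ((L h)%:E <= c)%E) -> (inner U <= c)%E.
Proof. by move=> Uc; apply: ge_ereal_sup => _ [h Uh <-]; exact: Uc. Qed.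

Lemma under0 U : under U (cst 0).
Proof. by split => // [|x]; [exact: cts_cst|rewrite /= lexx ler01]. Qed.

Lemma inner_ge0 U : (0 <= inner U)%E.
Proof.
by apply: le_trans (inner_ge (under0 U)); rewrite state_cst.
Qed.

Lemma inner_le1 U : (inner U <= 1)%E.
Proof.
apply: inner_le => h [ch h01 _]; rewrite lee_fin -(state_cst sL 1).
apply: (le_state sL ch) => [|x]; first exact: cts_cst.
by case/andP: (h01 x).
Qed.

Lemma inner_fin U : inner U \is a fin_num.
Proof.
rewrite ge0_fin_numE ?inner_ge0//.
by rewrite (le_lt_trans (inner_le1 _))// ltry.
Qed.

Lemma le_inner U V : U `<=` V -> (inner U <= inner V)%E.
Proof.
move=> UV; apply: inner_le => h [ch h01 h0]; apply: inner_ge; split => // x nVx.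
by apply: h0 => /UV.
Qed.

Lemma inner0 : inner set0 = 0%E.
Proof.
apply/eqP; rewrite eq_le inner_ge0 andbT; apply: inner_le => h [_ _ h0].
have -> : h = cst 0 by apply/funext => x; exact: h0.
by rewrite state_cst.
Qed.

Lemma innerT : inner setT = 1%E.
Proof.
apply/eqP; rewrite eq_le inner_le1/= -{1}(state_cst sL 1); apply: inner_ge.
split => [|x|x /(_ I)//]; first exact: cts_cst.
by rewrite /= lexx ler01.
Qed.

(** At a cost of at most [e] under a state, [h] is replaced by a function vanishing off the closed
    set [{e <= h}], which lies inside [U] when [h] is under [U] and [e > 0]. *)
Definition shave (e : R) h : K -> R := (h \- cst e) \max cst 0.

Lemma continuous_shave e h : continuous h -> continuous (shave e h).
Proof.
move=> ch; apply: cts_max; last exact: cts_cst.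
by apply: ctsB => //; exact: cts_cst.
Qed.

Lemma shave_itv e h : 0 <= e -> (forall x, 0 <= h x <= 1) ->
  forall x, 0 <= shave e h x <= 1.
Proof.
move=> e0 h01 x; rewrite /shave /= le_max lexx orbT/= ge_max ler01 andbT.
by case/andP: (h01 x) => _ h1; rewrite lerBlDr (le_trans h1)// lerDl.
Qed.

Lemma le_shave e h x : h x <= shave e h x + e.
Proof. by rewrite -lerBlDr /shave /= le_max lexx. Qed.

Lemma shave_eq0 e h x : h x <= e -> shave e h x = 0.
Proof. by move=> he; apply/max_idPr; rewrite /= subr_le0. Qed.

Lemma state_shave e h : continuous h -> L h <= L (shave e h) + e.
Proof.
move=> ch; rewrite -[X in _ + X](state_cst sL) -stateD//.
- apply: le_state => //; last by move=> x; exact: le_shave.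
  by apply: ctsD; [exact: continuous_shave|exact: cts_cst].
- exact: continuous_shave.
- exact: cts_cst.
Qed.

(** A Urysohn function that is 0 off [U] and 1 on the part of [{e <= h}] outside [V] splits
    [shave e h] into a summand under [U] and one under [V]. *)
Lemma innerU U V : open U -> open V -> (inner (U `|` V) <= inner U + inner V)%E.
Proof.
move=> oU oV; apply: inner_le => h [ch h01 h0].
apply/lee_addgt0Pr => e e0.
pose F := [set x | e <= h x] `&` ~` V.
have cF : closed F by apply: closedI; [exact: cts_closed_ge|exact: open_closedC].
have [|u [cu u01 u0 u1]] := urysohn_compact (open_closedC oU) cF.
  apply/seteqP; split => // x [nUx [/= hx nVx]].
  have : h x = 0 by apply: h0 => -[].
  by move=> hx0; move: hx; rewrite hx0 leNgt e0.
have cs := @continuous_shave e h ch.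
have s01 := shave_itv (ltW e0) h01.
have cs1 : continuous (shave e h \* u) by exact: ctsM.
have cs2 : continuous (shave e h \* (cst 1 \- u)).
  by apply: ctsM => //; apply: ctsB => //; exact: cts_cst.
have su : under U (shave e h \* u).
  split => // x => [|nUx] /=; last by rewrite u0 ?mulr0.
  by case/andP: (s01 x) (u01 x) => ? ? /andP[? ?]; rewrite mulr_ge0//= mulr_ile1.
have sv : under V (shave e h \* (cst 1 \- u)).
  split => // x => [|nVx] /=.
    case/andP: (s01 x) (u01 x) => ? ? /andP[? ?].
    by rewrite mulr_ge0 ?subr_ge0//= mulr_ile1 ?subr_ge0// gerBl.
  have [hx|hx] := leP e (h x); first by rewrite u1 ?subrr ?mulr0.
  by rewrite shave_eq0 ?mul0r// ltW.
apply: (@le_trans _ _ (L (shave e h \* u) + L (shave e h \* (cst 1 \- u)) + e)%:E).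
  rewrite lee_fin -stateD//.
  rewrite (_ : _ \+ _ = shave e h); first exact: state_shave.
  by apply/funext => x /=; rewrite -mulrDr addrC subrK mulr1.
by rewrite !EFinD leeD2r// leeD// inner_ge.
Qed.

Lemma inner_bigsetU (U : nat -> set K) n : (forall i, open (U i)) ->
  (inner (\big[setU/set0]_(i < n) U i) <= \sum_(i < n) inner (U i))%E.
Proof.
move=> oU; elim: n => [|n ih]; first by rewrite !big_ord0 inner0.
rewrite !big_ord_recr/=; apply: le_trans (leeD2r _ ih).
by apply: innerU => //; rewrite -bigcup_mkord; apply: bigcup_open.
Qed.

(** For [h] under the union, compactness puts [{e <= h}] inside finitely many [U i], and finite
    subadditivity applies to [shave e h]. *)
Lemma inner_bigcup (U : nat -> set K) : (forall i, open (U i)) ->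
  (inner (\bigcup_i U i) <= \sum_(i <oo) inner (U i))%E.
Proof.
move=> oU; apply: inner_le => h [ch h01 h0].
apply/lee_addgt0Pr => e e0.
have [|N FN] := @compact_bigcup_ord [set x | e <= h x] U (@cts_closed_ge h e ch) oU.
  move=> x /= hx; apply: contrapT => /h0 hx0.
  by move: hx; rewrite hx0 leNgt e0.
apply: (@le_trans _ _ (L (shave e h) + e)%:E).
  by rewrite lee_fin; exact: state_shave.
rewrite EFinD leeD2r//.
apply: (@le_trans _ _ (inner (\big[setU/set0]_(i < N) U i))).
  apply: inner_ge; split => [||x nx]; first exact: continuous_shave.
    exact: shave_itv (ltW e0) h01.
  apply: shave_eq0; rewrite leNgt; apply/negP => /ltW hx.
  exact/nx/FN.
apply: (le_trans (inner_bigsetU _ oU)).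
rewrite -(big_mkord xpredT (fun i => inner (U i))).
by apply: nneseries_lim_ge => i _ _; exact: inner_ge0.
Qed.

Lemma outer_le U E : open U -> E `<=` U -> (outer E <= inner U)%E.
Proof. by move=> oU EU; apply: ereal_inf_lbound; exists U. Qed.

Lemma outer_ge E c : (forall U, open U -> E `<=` U -> (c <= inner U)%E) ->
  (c <= outer E)%E.
Proof. by move=> Ec; apply: le_ereal_inf_tmp => _ [U [oU EU] <-]; exact: Ec. Qed.

Lemma outer_open U : open U -> outer U = inner U.
Proof.
move=> oU; apply/eqP; rewrite eq_le outer_le//=.
by apply: outer_ge => V _; exact: le_inner.
Qed.

Lemma outer_ge0 E : (0 <= outer E)%E.
Proof. by apply: outer_ge => U _ _; exact: inner_ge0. Qed.

Lemma outer_le1 E : (outer E <= 1)%E.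
Proof. by rewrite -innerT; apply: outer_le => //; exact: openT. Qed.

Lemma outer_fin E : outer E \is a fin_num.
Proof.
rewrite ge0_fin_numE ?outer_ge0//.
by rewrite (le_lt_trans (outer_le1 _))// ltry.
Qed.

Lemma outer_adherent E e : 0 < e ->
  exists U, [/\ open U, E `<=` U & (inner U < outer E + e%:E)%E].
Proof.
move=> e0; have := lb_ereal_inf_adherent e0 (outer_fin E).
by move=> [_ [U [oU EU] <-] Ue]; exists U.
Qed.

Lemma outer_sigma_subadditive A (F : nat -> set K) :
  A `<=` \bigcup_n F n -> (outer A <= \sum_(n <oo) outer (F n))%E.
Proof.
move=> AF; apply/lee_addgt0Pr => e e0.
apply: le_trans (epsilon_trick xpredT (fun n => outer_ge0 (F n)) (ltW e0)).
have /choice[U FU] n : exists U, [/\ open U, F n `<=` U &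
    (inner U < outer (F n) + (e / (2 ^ n.+1)%:R)%:E)%E].
  by apply: outer_adherent; rewrite divr_gt0// ltr0n expn_gt0.
have oU n : open (U n) by have [] := FU n.
apply: (@le_trans _ _ (inner (\bigcup_n U n))).
  apply: outer_le; first exact: bigcup_open.
  move=> x /AF[n _ Fx]; exists n => //.
  by have [_ + _] := FU n; apply.
apply: (le_trans (inner_bigcup oU)); apply: lee_nneseries => [n _ _|n _].
  exact: inner_ge0.
by have [_ _ /ltW] := FU n.
Qed.

Lemma outer_set0 : outer set0 = 0%E.
Proof. by rewrite outer_open ?inner0//; exact: open0. Qed.

(** Caratheodory's condition for open sets. If [h] is under the intersection of [U] and [V], and [g]
    is under [U] minus [{e <= h}], then [shave e h] and [g] are never both nonzero, so their sum is
    under [U]. *)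
Lemma outer_split V E : open V ->
  (outer (E `&` V) + outer (E `&` ~` V) <= outer E)%E.
Proof.
move=> oV; apply: outer_ge => U oU EU.
apply: (@le_trans _ _ (inner (U `&` V) + outer (E `&` ~` V))%E).
  rewrite leeD2r// outer_le//; first exact: openI.
  by move=> x [/EU].
rewrite -leeBrDr; last exact: outer_fin.
apply: inner_le => h [ch h01 h0].
rewrite leeBrDr; last exact: outer_fin.
apply/lee_addgt0Pr => e e0.
pose F := [set x | e <= h x].
have oUF : open (U `&` ~` F) by apply: openI => //; apply: closed_openC; exact: cts_closed_ge.
apply: (@le_trans _ _ ((L h)%:E + inner (U `&` ~` F))%E).
  rewrite leeD2l// outer_le// => x [/EU Ux nVx]; split => //.
  rewrite /F /= h0; last by case.
  by apply/negP; rewrite -ltNge.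
rewrite -leeBrDl//; apply: inner_le => g [cg g01 g0].
rewrite leeBrDl// -EFinD.
have cs := @continuous_shave e h ch.
apply: (@le_trans _ _ (L (shave e h \+ g) + e)%:E).
  rewrite lee_fin stateD// addrAC lerD2r; exact: state_shave.
rewrite EFinD leeD2r//; apply: inner_ge; split; first exact: ctsD.
  move=> x /=; have := shave_itv (ltW e0) h01 x.
  have [hx|hx] := leP e (h x); first by rewrite g0 ?addr0// => -[_]; exact.
  by rewrite shave_eq0 ?add0r// ltW.
by move=> x nUx; rewrite /= g0 ?addr0 ?shave_eq0 ?h0 ?ltW// => -[].
Qed.

(** In place of an integral formula for [L], the last two clauses say that [mu F] is the infimum of
    [L h] over the continuous [h >= 0] that are at least 1 on the closed set [F]. *)
Definition represents (mu : probability (borel K) R) : Prop :=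
  [/\ radon mu,
      forall F e, closed F -> 0 < e -> exists h,
        [/\ continuous h, forall x, 0 <= h x <= 1, forall x, F x -> h x = 1 &
            ((L h)%:E <= mu F + e%:E)%E] &
      forall F h, closed F -> continuous h -> (forall x, 0 <= h x) ->
        (forall x, F x -> 1 <= h x) -> (mu F <= (L h)%:E)%E].

Theorem riesz_markov : exists mu : probability (borel K) R, represents mu.
Proof.
pose om : {outer_measure set K -> \bar R} := HB.pack outer
  (isSubsetOuterMeasure.Build R K outer outer_set0 outer_ge0
     (fun A G => @outer_sigma_subadditive A G)).
have mcara (A : set (borel K)) : measurable A -> om.-caratheodory A.
  move: A; apply: smallest_sub.
  - split.
    + exact: caratheodory_measurable_set0.
    + move=> A mA; rewrite setTD; exact: caratheodory_measurable_setC.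
    + exact: caratheodory_measurable_bigcup.
  - move=> V oV; apply: le_caratheodory_measurable => E; exact: outer_split.
have sadd : semi_sigma_additive (outer : set (borel K) -> \bar R).
  move=> F mF tF mUF; apply: (caratheodory_measure_sigma_additive (mu := om)) => //.
    by move=> i; apply: mcara; exact: mF.
  exact: mcara.
have outerT : outer setT = 1%E by rewrite outer_open ?innerT//; exact: openT.
pose m : {measure set (borel K) -> \bar R} := HB.pack (outer : set (borel K) -> \bar R)
  (isMeasure.Build _ (borel K) R outer outer_set0 outer_ge0 sadd).
(* The total mass of [m] is 1, so normalizing changes no value and only supplies the probability
   structure; [dirac point] is the default for a null or infinite mass. *)
pose mu : probability (borel K) R := mnormalize m (dirac point).
have muE (V : set (borel K)) : mu V = outer V.
  by rewrite /mu /= /mnormalize /= outerT onee_eq0 /= invr1 mule1.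
have mo (V : set (borel K)) : open (V : set K) -> measurable V.
  by move=> oV; exact: sub_sigma_algebra.
have mc (V : set (borel K)) : closed (V : set K) -> measurable V.
  by move=> cV; rewrite -(setCK V); apply: measurableC; apply: mo; exact: closed_openC.
have muc (F : set K) : closed F -> mu F = (1 - inner (~` F))%E.
  move=> cF; rewrite -{1}(setCK F) probability_setC; last first.
    by apply: mo; exact: closed_openC.
  by rewrite muE outer_open//; exact: closed_openC.
exists mu; split.
- move=> B mB; apply/eqP; rewrite eq_le; apply/andP; split; last first.
    apply: ge_ereal_sup => _ [F [cF FB] <-].
    by apply: le_measure => //; rewrite inE//; exact: mc.
  apply/lee_addgt0Pr => e e0.
  have [U [oU BU Ue]] := @outer_adherent (~` B) e e0.
  apply: (@le_trans _ _ (mu (~` U) + e%:E)%E); last first.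
    rewrite leeD2r//; apply: ereal_sup_ubound; exists (~` U) => //.
    by split; [exact: open_closedC|move=> x nUx; apply: contrapT => /BU].
  rewrite (muc (~` U)); last exact: open_closedC.
  rewrite setCK -(setCK B) probability_setC; last exact: measurableC.
  move: Ue; rewrite muE -(fineK (inner_fin U)) -(fineK (outer_fin (~` B))).
  rewrite -?EFinB -?EFinD lte_fin lee_fin; lra.
- move=> F e cF e0.
  have [_ [g [cg g01 g0] <-]] := ub_ereal_sup_adherent e0 (inner_fin (~` F)).
  rewrite -/(inner _) => ge; exists (cst 1 \- g); split => //.
  + by apply: ctsB => //; exact: cts_cst.
  + by move=> x /=; case/andP: (g01 x) => ? ?; rewrite subr_ge0 gerBl; apply/andP.
  + by move=> x Fx; rewrite /= g0 ?subr0//; exact.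
  + rewrite muc// stateB//; last exact: cts_cst.
    rewrite state_cst//; move: ge; rewrite -(fineK (inner_fin (~` F))).
    rewrite -?EFinB -?EFinD lte_fin lee_fin; lra.
- move=> F h cF ch h0 h1; rewrite muc//.
  have cm : continuous (h \min cst 1) by apply: cts_min => //; exact: cts_cst.
  have um : under (~` F) (cst 1 \- (h \min cst 1)).
    split.
    + by apply: ctsB => //; exact: cts_cst.
    + move=> x /=; rewrite subr_ge0 ge_min lexx orbT/= gerBl.
      by rewrite le_min h0 ler01.
    + move=> x /contrapT/h1 hx /=; rewrite min_r// subrr//.
  have := inner_ge um; rewrite stateB//; last exact: cts_cst.
  rewrite state_cst// -(fineK (inner_fin (~` F))) !lee_fin.
  have : L (h \min cst 1) <= L h.
    by apply: le_state => // x; rewrite /= ge_min lexx.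
  lra.
Qed.

End riesz.

(** * A diffuse state from a Cantor scheme *)

Section factors.
Context (R : realType) (K : ptopologicalType).
Implicit Types (g : nat -> K -> R) (L : (K -> R) -> R).

(** For [K] compact and all [g n] continuous, these are the continuous functions of the point
    [(g n x)_n] of the image of [K] in the product; the condition on fibres avoids naming the outer
    function. *)
Definition factors g : set (K -> R) :=
  [set h | continuous h /\ forall x y, (forall n, g n x = g n y) -> h x = h y].

(** The closed sets [{1 <= w i}] cover [K], each of measure at most [e] for a measure representing
    [L]. Stated by functions in [factors g], this passes to every state agreeing with [L] there. *)
Definition diffuse g L : Prop := forall e, 0 < e ->
  exists (I : finType) (w : I -> K -> R),
    (forall i, [/\ factors g (w i), forall x, 0 <= w i x & L (w i) <= e]) /\
    (forall x, exists i, 1 <= w i x).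

End factors.

Section cantor_scheme.
Context (R : realType) (K : ptopologicalType).
Hypotheses (cK : compact [set: K]) (hK : hausdorff_space K).
Variable A : set K.
Hypotheses (A0 : A !=set0) (Aniso : ~ (isolated A !=set0)).
Implicit Types (V : set K) (s t : seq bool).

(** Interiors are taken so that both pieces are open sets meeting [A] and can be split again. *)
Let splits V (f : K -> R) : Prop :=
  [/\ continuous f, forall x, 0 <= f x <= 1 &
      forall b : bool, V `&` (f @^-1` [set b%:R])^° `&` A !=set0].

Lemma splitting V : open V -> V `&` A !=set0 -> exists f, splits V f.
Proof.
move=> oV [x [Vx Ax]].
have [y [Vy Ay yx]] : exists y, [/\ V y, A y & y <> x].
  apply: contrapT => noy; apply: Aniso; exists x; split; first exact: mem_set.
  exists V; first exact: open_nbhs_nbhs.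
  apply/seteqP; split => [y [Vy Ay]|y ->] //=.
  by apply: contrapT => yx; apply: noy; exists y.
have c1 (z : K) : closed [set z] by exact: (accessible_closed_set1 (hausdorff_accessible hK)).
have [|u [cu u01 u0 u1]] := @urysohn_compact R K cK hK [set x] [set y] (c1 x) (c1 y).
  by apply/seteqP; split => // z [-> /esym].
have ux : u x = 0 by exact: u0.
have uy : u y = 1 by exact: u1.
(* This truncation is 0 where [u <= 1/4] and 1 where [u >= 3/4], so that both level sets have
   interior points in [A]. *)
pose f := (cst 0 \max (cst 1 \min (2 *: u - cst 2^-1)))%R : K -> R.
have cf : continuous f.
  apply: cts_max; first exact: cts_cst.
  apply: cts_min; first exact: cts_cst.
  apply: (@ctsB _ _ (2 *: u) (cst 2^-1)); last exact: cts_cst.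
  by move=> z; apply: cvgZr; exact: cu.
exists f; split => //.
  by move=> z; rewrite /f /= le_max lexx ge_max ler01 ge_min lexx.
case.
- exists y; split => //; split => //=.
  have oW := @cts_open_gt R K u (3 / 4) cu.
  apply: (@filterS _ _ _ [set z | 3 / 4 < u z]).
    move=> z /= uz; rewrite /f /=.
    have uz' : 1 <= (2 *: u - cst 2^-1) z.
      rewrite [leRHS](_ : _ = 2 * u z - 2^-1)//; lra.
    by rewrite min_l// max_r.
  by apply: open_nbhs_nbhs; split => //=; rewrite uy; lra.
- exists x; split => //; split => //=.
  have oW := @cts_open_lt R K u (1 / 4) cu.
  apply: (@filterS _ _ _ [set z | u z < 1 / 4]).
    move=> z /= uz; rewrite /f /=.
    have uz' : (2 *: u - cst 2^-1) z <= 0.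
      rewrite [leLHS](_ : _ = 2 * u z - 2^-1)//; lra.
    by rewrite max_l// ge_min uz' orbT.
  by apply: open_nbhs_nbhs; split => //=; rewrite ux; lra.
Qed.

Lemma splitting_choice :
  exists phi : set K -> K -> R, forall V, open V -> V `&` A !=set0 -> splits V (phi V).
Proof.
suff /choice[phi phiP] V : exists f, open V -> V `&` A !=set0 -> splits V f.
  by exists phi.
have [oV|] := pselect (open V); last by exists (cst 0).
have [VA|] := pselect (V `&` A !=set0); last by exists (cst 0).
by have [f ?] := splitting oV VA; exists f.
Qed.

Section tree.
Variable phi : set K -> K -> R.
Hypothesis phiP : forall V, open V -> V `&` A !=set0 -> splits V (phi V).

(** The Cantor scheme; the head of [s] is the latest choice. *)
Let U := fix U s : set K :=
  if s is b :: s' then U s' `&` (phi (U s') @^-1` [set b%:R])^° else setT.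

Let UP s : open (U s) /\ U s `&` A !=set0.
Proof.
elim: s => [|b s [oU UA]]; first by rewrite setTI; split => //; exact: openT.
have [_ _ spl] := phiP oU UA.
by split; [apply: openI => //; exact: open_interior|exact: spl].
Qed.

Let phiU s : splits (U s) (phi (U s)).
Proof. by have [] := UP s; exact: phiP. Qed.

(** For [f] with values in the unit interval, one of the two legs equals 1 at every point, which
    makes the products [w] cover [K]; where [f] is 0 or 1 the other leg vanishes, which makes [w t]
    an indicator on the sets [U s] of its level. *)
Let leg (b : bool) (f : K -> R) : K -> R :=
  cst 1 \min (2 *: (if b then f else cst 1 \- f)).

Let w := fix w s : K -> R :=
  if s is b :: s' then w s' \* leg b (phi (U s')) else cst 1.

Let g (n : nat) : K -> R :=
  if unpickle n is Some s then phi (U s) else cst 0.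

Let gP n : continuous (g n) /\ forall x, 0 <= g n x <= 1.
Proof.
rewrite /g; case: (unpickle n) => [s|]; first by have [] := phiU s.
by split => [|x]; [exact: cts_cst|rewrite /= lexx ler01].
Qed.

Let phi_factors s x y : (forall n, g n x = g n y) -> phi (U s) x = phi (U s) y.
Proof. by move=> /(_ (pickle s)); rewrite /g pickleK. Qed.

Let leg_ge0 b s x : 0 <= leg b (phi (U s)) x.
Proof.
have [_ f01 _] := phiU s; have /andP[f0 f1] := f01 x.
rewrite /leg /= le_min ler01/=.
by case: b; apply: mulr_ge0 => //; rewrite /= subr_ge0.
Qed.

Let w_factors s : factors g (w s).
Proof.
elim: s => [|b s [cw fw]]; first by split => //; exact: cts_cst.
have [cf _ _] := phiU s; split => [|x y gxy].
  apply: ctsM => //; apply: cts_min; first exact: cts_cst.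
  have cb : continuous (if b then phi (U s) else cst 1 \- phi (U s)).
    by case: b => //; apply: ctsB => //; exact: cts_cst.
  by move=> x; apply: cvgZr; exact: cb.
rewrite /= (fw _ _ gxy) /leg /=; congr (_ * (Num.min _ _)).
rewrite [LHS](_ : _ = 2 * (if b then phi (U s) else cst 1 \- phi (U s)) x)//.
rewrite [RHS](_ : _ = 2 * (if b then phi (U s) else cst 1 \- phi (U s)) y)//.
by case: b; rewrite /= (phi_factors _ gxy).
Qed.

Let w_ge0 s x : 0 <= w s x.
Proof.
by elim: s => [|b s ih]; rewrite /= ?ler01//; apply: mulr_ge0 => //; exact: leg_ge0.
Qed.

Let w_cover n x : exists2 s, size s = n & 1 <= w s x.
Proof.
elim: n => [|n [s sn ws]]; first by exists [::] => //=.
have legE (b : bool) : 2^-1 <= (if b then phi (U s) x else 1 - phi (U s) x) ->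
    exists2 s, size s = n.+1 & 1 <= w s x.
  move=> le2; exists (b :: s); first by rewrite /= sn.
  rewrite /= [X in _ * X](_ : _ = 1) ?mulr1//; apply: min_l.
  rewrite [leRHS](_ : _ = 2 * (if b then phi (U s) x else 1 - phi (U s) x)).
    by rewrite -ler_pdivrMl// mulr1.
  by case: b {le2}.
have [le2|le2] := leP 2^-1 (phi (U s) x); first exact: (legE true).
by apply: (legE false) => /=; move: le2; lra.
Qed.

Let w_U s t x : size t = size s -> U s x -> w t x = (t == s)%:R.
Proof.
elim: s t => [|b s ih] [|b' t]//= [/ih wt] [Usx /interior_subset/= fx].
rewrite wt// eqseq_cons; have [->|_] := eqVneq t s; last by rewrite mul0r andbF.
rewrite mul1r andbT /leg /=.
rewrite [X in Num.min _ X](_ : _ = 2 * (if b' then phi (U s) x else 1 - phi (U s) x)).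
  rewrite fx; case: b b' {fx} => -[]; rewrite ?subr0 ?subrr ?mulr0 ?mulr1/=.
  - by apply: min_l; lra.
  - by apply: min_r; exact: ler01.
  - by apply: min_r; exact: ler01.
  - by apply: min_l; lra.
by case: b'.
Qed.

(* [a] is constant on each of the sets [U t] with [t] lying [n] levels above
   [s], and [c] is the average of the values. *)
Let avg := fix avg n s (a : K -> R) c : Prop :=
  if n is n'.+1 then exists c1 c2, [/\ avg n' (true :: s) a c1,
    avg n' (false :: s) a c2 & c = (c1 + c2) / 2]
  else forall x, U s x -> a x = c.

Let avg_lin n s k a c b d : avg n s a c -> avg n s b d ->
  avg n s (k *: a + b) (k * c + d).
Proof.
elim: n s c d => [|n ih] s c d /=.
  by move=> ac bd x Ux; rewrite -(ac _ Ux) -(bd _ Ux).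
move=> [c1 [c2 [a1 a2 ->]]] [d1 [d2 [b1 b2 ->]]].
exists (k * c1 + d1), (k * c2 + d2); split; [exact: ih|exact: ih|lra].
Qed.

Let avgS n s a c : avg n s a c -> avg n.+1 s a c.
Proof.
elim: n s c => [|n ih] s c.
  move=> ac; exists c, c; split; [by move=> x [/ac]|by move=> x [/ac]|lra].
move=> [c1 [c2 [a1 a2 ->]]]; exists c1, c2; split => //; exact: ih.
Qed.

Let avg_le m n s a c : (m <= n)%N -> avg m s a c -> avg n s a c.
Proof.
by move=> /subnKC <-; elim: (n - m)%N => [|k ih]; rewrite ?addn0// addnS => /ih/avgS.
Qed.

Let avg_ge0 n s a c : (forall x, 0 <= a x) -> avg n s a c -> 0 <= c.
Proof.
move=> a0; elim: n s c => [|n ih] s c.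
  by move=> ac; have [_ [x [Ux _]]] := UP s; rewrite -(ac _ Ux).
move=> [c1 [c2 [/ih ? /ih ? ->]]]; lra.
Qed.

(** On the [2 ^ n] sets lying [n] levels above [s], the function [w t] is 1 on [U t] and 0 on the
    others; [U t] is among them exactly when removing the [n] latest choices from [t] leaves [s]. *)
Let avg_w n s t : size t = (n + size s)%N ->
  avg n s (w t) (2^-1 ^+ n * (drop n t == s)%:R).
Proof.
elim: n s => [|n ih] s /= ts.
  by move=> x Ux; rewrite expr0 mul1r drop0; exact: w_U.
exists (2^-1 ^+ n * (drop n t == true :: s)%:R), (2^-1 ^+ n * (drop n t == false :: s)%:R).
split; [by apply: ih; rewrite /= addnS|by apply: ih; rewrite /= addnS|].
have -> : drop n.+1 t = behead (drop n t) by rewrite -drop1 drop_drop add1n.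
have : size (drop n t) = (size s).+1 by rewrite size_drop ts addSn subSn ?leq_addr// addKn.
case: (drop n t) => [//|b u] /= _; rewrite !eqseq_cons exprS.
by case: b; rewrite /= ?mulr0 ?addr0 ?add0r; ring.
Qed.

Lemma tree_diffuse : exists (g : nat -> K -> R) (L : (K -> R) -> R),
  [/\ forall n, continuous (g n) /\ forall x, 0 <= g n x <= 1, state L & diffuse g L].
Proof.
(* The averages are integrals for fair coin tossing along the branches. With [v = cst 0] and [r = 0]
   the additional bound in [state_extension] is again positivity. *)
pose G := [set p : (K -> R) * R | continuous p.1 /\ exists n, avg n [::] p.1 p.2].
have [||||||L [sL LG _]] := @state_extension R K G (cst 0) 0 cK.
- exact: cts_cst.
- by move=> a c [].
- move=> k a c b d [/= ca [m am]] [/= cb [n bn]]; split; first exact: ctsZD.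
  exists (maxn m n); apply: avg_lin; first exact: avg_le (leq_maxl _ _) am.
  exact: avg_le (leq_maxr _ _) bn.
- by split => /=; [exact: cts_cst|exists 0].
- by move=> a c [_ [n /= ac]] a0; exact: avg_ge0 ac.
- by move=> a c [_ [n /= ac]] a0; exact: avg_ge0 ac.
exists g, L; split => // e e0.
have [n ne] : exists n, 2^-1 ^+ n <= e.
  have [n _ /(_ n)] := @near_infty_natSinv_expn_lt R (PosNum e0).
  by move=> /(_ (leqnn n)) /= ne; exists n; rewrite exprVn -[leLHS]mul1r ltW.
exists {tuple n of bool}, (fun t : n.-tuple bool => w (tval t)); split => [t|x].
  split; [exact: w_factors|exact: w_ge0|].
  have tn : size t = (n + size (Nil bool))%N by rewrite size_tuple addn0.
  have := avg_w tn; rewrite drop_oversize ?size_tuple// eqxx mulr1 => wn.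
  by rewrite (LG _ (2^-1 ^+ n))//; split; [have [] := w_factors t|exists n].
have [s sn ws] := w_cover n x.
by exists (Tuple (introT eqP sn)).
Qed.

End tree.

Lemma exists_diffuse_state : exists (g : nat -> K -> R) (L : (K -> R) -> R),
  [/\ forall n, continuous (g n) /\ forall x, 0 <= g n x <= 1, state L & diffuse g L].
Proof. by have [phi phiP] := splitting_choice; exact: tree_diffuse phiP. Qed.

End cantor_scheme.

(** * Chains of states *)

Section factors_theory.
Context (R : realType) (K : ptopologicalType).
Implicit Types (g : nat -> K -> R) (a h : K -> R).

Lemma factors_cst g c : factors g (cst c).
Proof. by split => //; exact: cts_cst. Qed.

Lemma factorsZD g k a h : factors g a -> factors g h -> factors g (k *: a + h).
Proof.
move=> [ca fa] [ch fh]; split => [|x y gxy]; first exact: ctsZD.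
by rewrite [LHS](_ : _ = k * a x + h x)// (fa x y gxy) (fh x y gxy).
Qed.

Lemma factorsB g a h : factors g a -> factors g h -> factors g (a \- h).
Proof.
move=> [ca fa] [ch fh]; split => [|x y gxy]; first exact: ctsB.
by rewrite /= (fa x y gxy) (fh x y gxy).
Qed.

Lemma factors_abs g a : factors g a -> factors g (fun x => `|a x|).
Proof.
by move=> [ca fa]; split => [|x y gxy]; [exact: cts_abs|rewrite (fa x y gxy)].
Qed.

Lemma factors_dist g a h : factors g a -> factors g h ->
  factors g (fun x => `|a x - h x|).
Proof. by move=> fa fh; apply: factors_abs; exact: factorsB. Qed.

Lemma sub_factors g g' :
  (forall x y, (forall n, g' n x = g' n y) -> forall n, g n x = g n y) ->
  factors g `<=` factors g'.
Proof. by move=> gg' h [ch fh]; split => // x y /gg'; exact: fh. Qed.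

End factors_theory.

Section nodes.
Context (R : realType) (K : ptopologicalType).
Implicit Types (a h : K -> R).

Definition node : Type := ((nat -> K -> R) * ((K -> R) -> R))%type.

Implicit Types (p q r t : node) (X : set node).

Definition unit_valued h : Prop := forall x, 0 <= h x <= 1.

Definition good p : Prop :=
  [/\ forall n, continuous (p.1 n) /\ unit_valued (p.1 n), state p.2 &
      diffuse p.1 p.2].

Definition extends p q : Prop :=
  factors p.1 `<=` factors q.1 /\ forall h, factors p.1 h -> q.2 h = p.2 h.

(* The functions factoring through [p.1] are not dense, for the [L_1]
   seminorm of [q.2], among those factoring through [q.1]. *)
Definition below p q : Prop := extends p q /\
  exists h e, [/\ factors q.1 h, unit_valued h, 0 < e &
    forall a, factors p.1 a -> unit_valued a -> e <= q.2 (fun x => `|h x - a x|)].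

Lemma extends_refl p : extends p p.
Proof. by split. Qed.

Lemma extends_trans p q r : extends p q -> extends q r -> extends p r.
Proof.
by move=> [pq pqE] [qr qrE]; split => [h /pq/qr//|h ph]; rewrite qrE ?pqE//; exact: pq.
Qed.

Lemma factors_extends p q h : extends p q -> factors p.1 h -> factors q.1 h.
Proof. by case=> pq _; exact: pq. Qed.

Lemma extends_below p q r : extends p q -> below q r -> below p r.
Proof.
move=> pq [qr [h [e [rh h01 e0 he]]]]; split; first exact: extends_trans qr.
by exists h, e; split => // a pa; apply: he; exact: factors_extends pq _.
Qed.

(** Otherwise [h] itself could serve as [a], giving [e <= 0]. *)
Lemma below_not_extends p q : good q -> below p q -> ~ extends q p.
Proof.
move=> [_ sq _] [_ [h [e [qh h01 e0 he]]]] [qp _].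
have := he _ (qp _ qh) h01; rewrite leNgt => /negP; apply.
rewrite (_ : (fun x => _) = cst 0) ?state_cst//.
by apply/funext => x; rewrite subrr normr0.
Qed.

Lemma below_extends_refl p q : p = q \/ below p q -> extends p q.
Proof. by move=> [->|[]//]; exact: extends_refl. Qed.

Definition chain X : Prop := X `<=` good /\
  forall p q, X p -> X q -> [\/ p = q, below p q | below q p].

(** A good pair above all members of a maximal chain could be added to it. *)
Lemma maximal_chain p : good p ->
  exists X, [/\ chain X, X !=set0 & forall q, good q -> ~ forall r, X r -> below r q].
Proof.
move=> gp; have [F FP Ftot|X [cX Xmax]] := @Zorn_bigcup _ chain.
  split; first by move=> q [Y FY Yq]; have [+ _] := FP _ FY; exact.
  move=> q r [Y FY Yq] [Z FZ Zr].
  have [YZ|ZY] := Ftot _ _ FY FZ.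
    by have [_ +] := FP _ FZ; apply => //; exact: YZ.
  by have [_ +] := FP _ FY; apply => //; exact: ZY.
have X0 : X !=set0.
  apply: contrapT => /nonemptyPn X0; apply: (Xmax [set p]).
    by rewrite X0; split => // /(_ p erefl).
  by split => [_ ->//|_ _ -> ->]; constructor 1.
exists X; split => // q gq Xq.
have nXq : ~ X q.
  by move=> /Xq qq; apply: (below_not_extends gq qq); case: qq.
apply: (Xmax (X `|` [set q])).
  by split => [r|/(_ q (or_intror erefl))//]; left.
have [Xg Xc] := cX; split => [r [/Xg//|->//]|r s [Xr|->] [Xs|->]].
- exact: Xc.
- by constructor 2; exact: Xq.
- by constructor 3; exact: Xq.
- by constructor 1.
Qed.

(** Along a chain the states agree on common domains, so their restrictions to [factors p.1] unite
    to a positive functional on a subspace. *)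
Lemma chain_state X : compact [set: K] -> chain X -> X !=set0 ->
  exists L, state L /\ forall p h, X p -> factors p.1 h -> L h = p.2 h.
Proof.
move=> cK [Xg Xc] [p0 Xp0].
have up p q : X p -> X q -> exists r, [/\ X r, extends p r & extends q r].
  move=> Xp Xq; have refl := extends_refl.
  have [<-|[pq _]|[qp _]] := Xc _ _ Xp Xq; first by exists p.
    by exists q.
  by exists p.
have gstate p : X p -> state p.2 by move=> /Xg[].
pose G := [set u : (K -> R) * R | exists p, [/\ X p, factors p.1 u.1 & u.2 = p.2 u.1]].
have Gpos a c : G (a, c) -> (forall x, 0 <= a x) -> 0 <= c.
  move=> [p [Xp [/= ca _] ->]] a0; exact: (state_ge0 (gstate _ Xp)).
have [||||||L [sL LG _]] := @state_extension R K G (cst 0) 0 cK.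
- exact: cts_cst.
- by move=> a c [p [_ [] ]].
- move=> k a c b d [p [Xp /= fa ->]] [q [Xq /= fb ->]].
  have [r [Xr [pr prE] [qr qrE]]] := up _ _ Xp Xq.
  exists r; split => //=; first by apply: factorsZD; [exact: pr|exact: qr].
  have [lin _ _] := gstate _ Xr; have [ca _] := fa; have [cb _] := fb.
  by rewrite -prE// -qrE// -lin.
- exists p0; split => //=; first exact: factors_cst.
  by rewrite state_cst//; exact: gstate.
- exact: Gpos.
- exact: Gpos.
exists L; split => // p h Xp ph; apply: LG; exists p; split => //.
Qed.

Lemma diffuse_extends p q : extends p q -> diffuse p.1 p.2 -> diffuse q.1 q.2.
Proof.
move=> [pq pqE] pd e /pd[I [w [wP w1]]]; exists I, w; split => // i.
by have [pw w0 we] := wP i; split => //; [exact: pq|rewrite pqE].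
Qed.

(* The sequence of [t] enumerates all the functions [(c k).1 j]. *)
Lemma maximal_node X (c : nat -> node) : compact [set: K] ->
  chain X -> (forall q, good q -> ~ forall r, X r -> below r q) ->
  (forall k, X (c k)) -> (forall p, X p -> exists k, p = c k \/ below p (c k)) ->
  exists t, good t /\ forall q, good q -> ~ below t q.
Proof.
move=> cK cX Xmax Xc cof.
have [L [sL LX]] : exists L, state L /\ forall p h, X p -> factors p.1 h -> L h = p.2 h.
  by apply: chain_state => //; exists (c 0%N).
pose g n := if unpickle n is Some (k, j) then (c k).1 j else cst 0.
have ct k : extends (c k) (g, L).
  split => [|h]; last by apply: LX.
  apply: sub_factors => x y gxy j.
  by have := gxy (pickle (k, j)); rewrite /g /= pickleK.
have Xt p : X p -> extends p (g, L).
  by move=> /cof[k /below_extends_refl pk]; exact: extends_trans (ct k).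
have [Xg _] := cX.
exists (g, L); split; last first.
  (* By cofinality [(g, L)] extends the whole chain, so anything above it would lie above every
     member. *)
  by move=> q gq tq; apply: (Xmax q gq) => r /Xt rt; exact: extends_below tq.
split => //; last by have [_ _ dc] := Xg _ (Xc 0%N); exact: diffuse_extends (ct 0%N) dc.
move=> n; rewrite /g /=; case: (unpickle n) => [[k j]|].
  by have [+ _ _] := Xg _ (Xc k); exact.
by split => [|x]; [exact: cts_cst|rewrite /= lexx ler01].
Qed.

End nodes.

(** * Maximal states *)

Section measures_of_states.
Context (R : realType) (K : ptopologicalType).
Hypotheses (cK : compact [set: K]) (hK : hausdorff_space K).
Implicit Types (mu : probability (borel K) R) (L : (K -> R) -> R).

Lemma borel_open (V : set K) : open V -> measurable (V : set (borel K)).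
Proof. exact: sub_sigma_algebra. Qed.

Lemma borel_closed (F : set K) : closed F -> measurable (F : set (borel K)).
Proof.
move=> cF; rewrite -(setCK F); apply: measurableC; apply: borel_open.
exact: closed_openC.
Qed.

(** For [e] half of [mu A], finitely many sets [{1 <= w i}] of measure at most [e] cover [A], and
    one of them meets [A] in positive measure. *)
Lemma nonatomic_of_diffuse L mu g : represents L mu -> diffuse g L -> nonatomic mu.
Proof.
move=> [_ _ muL] gd A mA A0.
have muA : mu A \is a fin_num by exact: fin_num_measure.
have e0 : 0 < fine (mu A) / 2 by rewrite divr_gt0// fine_gt0// A0 ltey_eq muA.
have [I [w [wP w1]]] := gd _ e0.
pose F i := [set x | 1 <= w i x].
have cF i : closed (F i) by apply: cts_closed_ge; have [[]] := wP i.
have mF i : measurable (A `&` F i : set (borel K)).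
  by apply: measurableI => //; exact: borel_closed.
have muF i : (mu (F i) <= (fine (mu A) / 2)%:E)%E.
  have [[cw _] w0 we] := wP i; apply: (@le_trans _ _ (L (w i))%:E).
    exact: muL.
  by rewrite lee_fin.
have [i Fi0] : exists i, (0 < mu (A `&` F i))%E.
  apply: contrapT => noi.
  have F0 i : mu (A `&` F i) = 0%E.
    apply/eqP; rewrite eq_le measure_ge0 andbT leNgt; apply/negP => i0.
    by apply: noi; exists i.
  have [mU U0] : measurable (\big[setU/set0]_(i : I) (A `&` F i) : set (borel K)) /\
      mu (\big[setU/set0]_(i : I) (A `&` F i)) = 0%E.
    elim/big_ind: _ => [|S T [mS S0] [mT T0]|i _]; last by split.
      by split; [exact: measurable0|exact: measure0].
    split; first exact: measurableU.
    apply/eqP; rewrite eq_le measure_ge0 andbT.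
    by apply: (le_trans (measureU2 mu mS mT)); rewrite [X in (X + _)%E]S0 [X in (_ + X)%E]T0 adde0.
  have : (mu A <= mu (\big[setU/set0]_(i : I) (A `&` F i)))%E.
    apply: le_measure; rewrite ?inE// => x Ax.
    have [i wi] := w1 x.
    by rewrite -bigcup_seq; exists i => //=; rewrite mem_index_enum.
  by rewrite U0 leNgt A0.
exists (A `&` F i); split => //; apply: (@le_lt_trans _ _ (fine (mu A) / 2)%:E).
  apply: (le_trans _ (muF i)); apply: le_measure; rewrite ?inE//.
  exact: borel_closed.
rewrite -[ltRHS]fineK// lte_fin; move: e0; lra.
Qed.

(* Otherwise some extension of the functional from the functions factoring
   through [g] would give [h] a larger value; its average with [L] contradicts
   maximality, because both values are within a small distance of that of a
   function factoring through [g]. *)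
Lemma maximal_state (t : node R K) h c : good t ->
  (forall q, good q -> ~ below t q) -> continuous h -> unit_valued h ->
  (forall a, factors t.1 a -> (forall x, h x <= a x) -> c <= t.2 a) ->
  c <= t.2 h.
Proof.
case: t => g L [/= g01 sL gd] tmax ch h01 hc.
pose G := [set u : (K -> R) * R | factors g u.1 /\ u.2 = L u.1].
have [|||||L' [sL' L'G cL']] := @state_extension R K G h c cK ch.
- by move=> a d [[]].
- move=> k a d b e [/= fa ->] [/= fb ->]; split; first exact: factorsZD.
  by have [lin _ _] := sL; rewrite lin//; [case: fa|case: fb].
- by split; [exact: factors_cst|rewrite /= state_cst].
- by move=> a d [/= [ca _] ->] a0; exact: state_ge0.
- by move=> a d [/= fa ->]; exact: hc.
pose M f := 2^-1 * L f + 2^-1 * L' f.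
have ME f : factors g f -> M f = L f.
  by move=> ff; rewrite /M (L'G f (L f))//; lra.
have sM : state M.
  have [lin pos L1] := sL; have [lin' pos' L1'] := sL'; split.
  - by move=> k f f' cf cf'; rewrite /M lin// lin'//; ring.
  - by move=> f cf f0; rewrite /M addr_ge0// mulr_ge0// ?pos ?pos'.
  - by rewrite /M L1 L1'; lra.
pose g' n := if n is n'.+1 then g n' else h.
have gg' : extends (g, L) (g', M).
  split => [|f ff]; last exact: ME.
  by apply: sub_factors => x y gxy n; exact: (gxy n.+1).
have g'h : factors g' h by split => // x y /(_ 0%N).
apply/ler_addgt0Pr => e e0.
have e4 : 0 < e / 4 by rewrite divr_gt0.
have [a [fa a01 ae]] : exists a, [/\ factors g a, unit_valued a &
    M (fun x => `|h x - a x|) < e / 4].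
  (* Without such an [a], the function [h] would witness that [(g', M)] is above [(g, L)]. *)
  apply: contrapT => noa; apply: (tmax (g', M)).
    split => //=; first by case.
    exact: diffuse_extends gg' gd.
  split => //; exists h, (e / 4); split => // a fa a01.
  by rewrite leNgt; apply/negP => ?; apply: noa; exists a.
have [ca _] := fa.
have cd : continuous (fun x => `|h x - a x|) by apply: cts_abs; exact: ctsB.
have dist N : state N -> N h - N a <= N (fun x => `|h x - a x|) /\
    N a - N h <= N (fun x => `|h x - a x|).
  move=> sN; rewrite -!stateB//; split; apply: (le_state sN) => //.
  - exact: ctsB.
  - by move=> x; exact: ler_norm.
  - exact: ctsB.
  - by move=> x; rewrite distrC; exact: ler_norm.
have [_ d1] := dist _ sL; have [d2 _] := dist _ sL'.
have d3 : 0 <= L (fun x => `|h x - a x|) by exact: state_ge0.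
have d4 : 0 <= L' (fun x => `|h x - a x|) by exact: state_ge0.
have d5 : L' a = L a by apply: L'G.
move: ae cL' d1 d2 d3 d4 d5; rewrite /M /=; lra.
Qed.

Lemma maximal_strongly_countably_determined (t : node R K) mu : good t ->
  (forall q, good q -> ~ below t q) -> represents t.2 mu ->
  strongly_countably_determined mu.
Proof.
move=> tg tmax [_ mu_ge mu_le]; have [g01 _ _] := tg.
pose f (x : K) : {ptws nat -> R} := fun n => t.1 n x.
have cf : continuous f.
  move=> x; apply/pointwise_cvgP => n; have [cn _] := g01 n; exact: cn.
exists f; split => //.
  by move=> _ [x _ <-] n /=; rewrite in_itv/=; have [_ +] := g01 n; apply.
move=> F cF; have Fcl := compact_closed hK cF.
have Gcl : closed (f @^-1` (f @` F)).
  apply: closed_comp => [x _|]; first exact: cf.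
  apply: compact_closed; first exact: hausdorff_product.
  by apply: continuous_compact => //; exact: continuous_subspaceT.
have FG : F `<=` f @^-1` (f @` F) by move=> x Fx; exists x.
have mG := borel_closed Gcl; have mF := borel_closed Fcl.
apply/eqP; rewrite eq_le le_measure ?inE//=.
apply/lee_addgt0Pr => e e0.
have [h [ch h01 h1 hF]] := mu_ge F e Fcl e0.
apply: le_trans hF; rewrite -[leLHS]fineK ?fin_num_measure// lee_fin.
(* A function [a >= h] factoring through the sequence is at least 1 on [F], hence, being constant on
   fibres, on the saturation of [F], whose measure therefore bounds [t.2 a] from below. *)
apply: maximal_state => // a [ca fa] ha.
rewrite -lee_fin fineK ?fin_num_measure//; apply: mu_le => //.
  by move=> x; apply: le_trans (ha x); case/andP: (h01 x).
move=> x [y Fy fyx]; rewrite -(h1 _ Fy) (fa x y); first exact: ha.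
by move=> n; rewrite -[LHS]/(f x n) -fyx.
Qed.

End measures_of_states.

(** * The space L_1 of a measure *)

Section L1.
Context (R : realType) (K : ptopologicalType) (mu : probability (borel K) R).
Local Open Scope ereal_scope.
Implicit Types (f g h : borel K -> R).

Lemma cts_measurable (f : K -> R) :
  continuous f -> measurable_fun setT (f : borel K -> R).
Proof.
move=> cf; apply: (measurability (@RGenCInfty.G R)).
  exact: RGenCInfty.measurableE.
move=> _ [_ [x ->] <-]; rewrite setTI; apply: borel_closed.
rewrite (_ : _ @^-1` _ = [set y | x <= f y]%R); first exact: cts_closed_ge.
by apply/seteqP; split => y; rewrite /= in_itv/= andbT.
Qed.

Definition dist1 f g : \bar R := 'N[mu]_1[(fun x => (f x - g x)%:E)].

Lemma dist1E f g : dist1 f g = \int[mu]_x `|(f x - g x)%:E|.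
Proof. exact: Lnorm1. Qed.

Lemma dist1C f g : dist1 f g = dist1 g f.
Proof. by rewrite !dist1E; apply: eq_integral => x _; rewrite !abse_EFin distrC. Qed.

Lemma dist1_triangle g f h : measurable_fun setT f -> measurable_fun setT g ->
  measurable_fun setT h -> dist1 f h <= dist1 f g + dist1 g h.
Proof.
move=> mf mg mh.
rewrite (_ : dist1 f h = 'N[mu]_1[EFin \o ((f \- g) \+ (g \- h))%R]); last first.
  by apply: eq_Lnorm => x; rewrite /= addrA subrK.
by apply: eminkowski => //; exact: measurable_funB.
Qed.

(* The library's [L_1] space uses [measurableTypeR R], whose measurable
   structure is convertible to, but not unifiable with, that of [R]. *)
Lemma mfun_measurable (f : {mfun borel K >-> measurableTypeR R}) :
  measurable_fun setT (f : borel K -> R).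
Proof.
by move=> mT Y mY; exact: (@measurable_funPT _ _ _ (measurableTypeR R) f mT Y mY).
Qed.

Lemma Lspace1_measurable (F : LspaceType1 mu) : measurable_fun setT (F : borel K -> R).
Proof.
exact: (mfun_measurable (repr (F : {mfun_ mu, borel K >-> measurableTypeR R}))).
Qed.

(** [F] is the class of [h]. Its underlying function is a chosen representative, equal to [h] only
    almost everywhere, whence a conclusion about distances. *)
Lemma dist1_Lspace1 h : measurable_fun setT h -> (forall x, 0 <= h x <= 1)%R ->
  exists F : LspaceType1 mu, forall g, measurable_fun setT g -> dist1 F g = dist1 h g.
Proof.
move=> mh h01.
pose hm : {mfun borel K >-> measurableTypeR R} := HB.pack h
  (isMeasurableFun.Build _ _ (borel K) (measurableTypeR R) h mh).
pose q : {mfun_ mu, borel K >-> measurableTypeR R} := (\pi_({mfun_ mu, borel K >-> measurableTypeR R}) hm)%qT.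
have qh : (q : borel K -> R) = h %[ae mu].
  have : (repr q = hm %[mod {mfun_ mu, borel K >-> measurableTypeR R}])%qT by rewrite reprK.
  by move=> /eqP; rewrite eqmodE => /asboolP.
have mq : measurable_fun setT (q : borel K -> R) by exact: mfun_measurable.
have qE g : measurable_fun setT g -> dist1 q g = dist1 h g.
  move=> mg; rewrite !dist1E; apply: ae_eq_integral => //.
  - by apply: measurableT_comp => //; apply/measurable_EFinP; exact: measurable_funB.
  - by apply: measurableT_comp => //; apply/measurable_EFinP; exact: measurable_funB.
  - by apply: filterS qh => x /(_ I) /= ->.
have fq : finite_norm mu 1 q.
  have := qE (cst 0%R) (measurable_cst _).
  rewrite /finite_norm /dist1 [X in X = _ -> _](_ : _ = 'N[mu]_1[EFin \o q]); last first.
    by apply: eq_Lnorm => x; rewrite /= subr0.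
  move=> ->; rewrite Lnorm1.
  apply: (@le_lt_trans _ _ (\int[mu]_x (cst 1 x))).
    apply: ge0_le_integral => //.
    + apply: measurableT_comp => //; apply/measurable_EFinP; exact: measurable_funB.
    + by move=> x _; rewrite /= subr0 lee_fin ger0_norm; case/andP: (h01 x).
  rewrite integral_cst// mul1e.
  exact: (le_lt_trans (probability_le1 mu measurableT) (ltry 1)).
pose F : LspaceType1 mu := HB.pack q
  (isFinLebesgue.Build _ (borel K) R mu 1 (@lexx _ _ 1) q fq).
by exists F.
Qed.

End L1.

(** * Uncountable density of L_1 *)

Section maharam_type.
Context (R : realType) (K : ptopologicalType).
Implicit Types (mu : probability (borel K) R) (L : (K -> R) -> R) (X : set (node R K)).

(* Cardinals are well ordered: a maximal set of choice functions with all
   evaluations injective has some evaluation onto, and this is the minimum. *)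
Lemma least_cardinal (T : Type) (P : set (set T)) : P !=set0 ->
  exists2 D, P D & forall E, P E -> (D #<= E)%card.
Proof.
move=> [D1 PD1].
pose Q (X : set (set T -> T)) := (forall f D, X f -> P D -> D (f D)) /\
  (forall f f' D, X f -> X f' -> P D -> f D = f' D -> f = f').
have [F FQ Ftot|X [[XP Xinj] Xmax]] := @Zorn_bigcup _ Q.
  split=> [f D [Y FY Yf]|f f' D [Y FY Yf] [Z FZ Zf]].
    by have [+ _] := FQ _ FY; exact.
  have [YZ|ZY] := Ftot _ _ FY FZ.
    by have [_] := FQ _ FZ; apply => //; exact: YZ.
  by have [_] := FQ _ FY; apply => //; exact: ZY.
have [D PD Donto] : exists2 D, P D & forall y, D y -> exists2 f, X f & f D = y.
  apply: contrapT => noD.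
  have /choice[f fP] D : exists y : T, P D -> D y /\ forall f, X f -> f D <> y.
    have [PD|nPD] := pselect (P D); last first.
      have [y _] : exists y : T, True.
        apply: contrapT => noy; apply: noD; exists D1 => // y.
        by exfalso; apply: noy; exists y.
      by exists y.
    apply: contrapT => noy; apply: noD; exists D => // y Dy.
    apply: contrapT => nof; apply: noy; exists y => _; split => // f Xf fD.
    by apply: nof; exists f.
  apply: (Xmax (X `|` [set f])).
    split; first by move=> ?; left.
    by move=> /(_ f (or_intror erefl)) /(proj2 (fP _ PD1)).
  split=> [g D [Xg|->] PD|g g' D [Xg|->] [Xg'|->] PD].
  - exact: (XP g D Xg PD).
  - by have [] := fP _ PD.
  - exact: (Xinj g g' D Xg Xg' PD).
  - by have [_ /(_ _ Xg)] := fP _ PD.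
  - by have [_ /(_ _ Xg')] := fP _ PD; move=> + /esym.
  - by [].
exists D => // E PE.
have inj : {in X &, injective (fun f : set T -> T => f E)}.
  by move=> f f' /set_mem Xf /set_mem Xf'; exact: (Xinj f f' E Xf Xf' PE).
apply: (@card_le_trans _ _ _ ((fun f : set T -> T => f D) @` X)).
  by apply: subset_card_le => y /Donto[f Xf <-]; exists f.
apply: (card_le_trans (card_image_le _ _)).
apply: (@card_le_trans _ _ _ ((fun f : set T -> T => f E) @` X)).
  by have := inj_card_eq inj; rewrite card_eq_le => /andP[].
by apply: subset_card_le => _ [f Xf <-]; exact: (XP f E Xf PE).
Qed.

Lemma uncountable_maharam_typeP mu :
  (forall D : set (LspaceType1 mu), L1_dense D -> ~ countable D) ->
  uncountable_maharam_type mu.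
Proof.
move=> mu_unc.
have [|D Ddense Dmin] := @least_cardinal (LspaceType1 mu) (@L1_dense R K mu).
  exists setT => f e e0; exists f => //.
  rewrite (_ : ('N[mu]_1[_])%E = 0%E) ?lte_fin// Lnorm1.
  by under eq_integral => x _ do rewrite subrr /= normr0; rewrite integral0.
exists D; split; last exact: mu_unc.
by split => //; exists D.
Qed.

(** By Markov's inequality the set where [|f - g| >= e] has measure below [e]; a function [h] equal
    to 1 there has [L h < 2 * e], and [|f - g| <= h + e] everywhere. *)
Lemma state_le_dist1 L mu (f g : K -> R) e : represents L mu -> state L ->
  continuous f -> continuous g -> unit_valued f -> unit_valued g -> 0 < e ->
  (dist1 mu f g < (e * e)%:E)%E -> L (fun x => `|f x - g x|) <= 3 * e.
Proof.
move=> [_ mu_ge _] sL cf cg f01 g01 e0 fg.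
pose u x := `|f x - g x|.
have cu : continuous u by apply: cts_abs; exact: ctsB.
pose F := [set x | e <= u x].
have cF : closed F by exact: cts_closed_ge.
have muF : (mu F < e%:E)%E.
  rewrite -(@lte_pmul2l _ e%:E)// -EFinM; apply: le_lt_trans fg.
  rewrite dist1E.
  have := @le_integral_abse _ _ _ mu setT measurableT (fun x => (f x - g x)%:E) e.
  rewrite setTI; apply => //.
  apply/measurable_EFinP; apply: cts_measurable; exact: ctsB.
have [h [ch h01 h1 hF]] := mu_ge F e cF e0.
have : L h < 2 * e.
  have muFfin : mu F \is a fin_num by apply: fin_num_measure; exact: borel_closed.
  move: hF muF; rewrite -(fineK muFfin) -EFinD lee_fin lte_fin; lra.
have : L u <= L (h \+ cst e).
  apply: le_state => // [|x]; first by apply: ctsD => //; exact: cts_cst.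
  case/andP: (f01 x) (g01 x) (h01 x) => f0 f1 /andP[g0 g1] /andP[h0 hh1] /=.
  have [eu|ue] := leP e (u x); last by rewrite (le_trans (ltW ue))// lerDr.
  rewrite h1//; apply: (@le_trans _ _ 1); last by rewrite lerDl ltW.
  by rewrite /u ler_norml; lra.
rewrite stateD//; last exact: cts_cst.
rewrite state_cst// /u; lra.
Qed.

Lemma chain_uncountable X L mu : chain X ->
  (forall c : nat -> node R K, (forall k, X (c k)) ->
     exists2 p, X p & forall k, below (c k) p) ->
  state L -> (forall p h, X p -> factors p.1 h -> L h = p.2 h) ->
  represents L mu -> X !=set0 ->
  forall D : set (LspaceType1 mu), L1_dense D -> ~ countable D.
Proof.
move=> cX Xunb sL LX Lmu [p0 Xp0] D Ddense /countable_injP[f finj].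
(* The element of [D] with code [j] is within [1 / (i + 1)] of a function factoring through
   [p.1]. *)
pose near_at (j i : nat) (p : node R K) := exists x a,
  [/\ D x, f x = j, factors p.1 a, unit_valued a & (dist1 mu x a < (i.+1%:R^-1)%:E)%E].
(* For every [(j, i)] a pair of the chain is fixed that achieves this approximation if any pair of
   the chain does; [p0] is the default. *)
have /choice[c cP] (n : nat) : exists p, X p /\ forall j i, unpickle n = Some (j, i) ->
    (exists2 q, X q & near_at j i q) -> near_at j i p.
  case: (unpickle n) => [[j i]|]; last by exists p0.
  have [[q Xq nq]|no] := pselect (exists2 q, X q & near_at j i q).
    by exists q; split => // _ _ [<- <-].
  by exists p0; split => // _ _ [<- <-] /no.
have Xc k : X (c k) by have [] := cP k.
have [p Xp cp] := Xunb _ Xc.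
(* [p] is above all the fixed pairs, and [q] above [p] supplies a function [h] at distance at least
   [e] from those factoring through [p.1]. *)
have [q Xq /(_ 0%N)] := Xunb (fun=> p) (fun=> Xp).
move=> [pq [h [e [qh h01 e0 he]]]].
have e4 : 0 < e / 4 by rewrite divr_gt0.
(* Half of [(e / 4) ^ 2] for each of the steps from [h] to an element of [D] and from there to [a];
   [state_le_dist1] then yields [3 * (e / 4) < e]. *)
have d0 : 0 < (e / 4) * (e / 4) / 2 by rewrite divr_gt0// mulr_gt0.
have [i id] : exists i : nat, i.+1%:R^-1 < (e / 4) * (e / 4) / 2.
  have [N _ /(_ N (leqnn N)) Nd] := @near_infty_natSinv_lt R (PosNum d0).
  by exists N.
have [ch _] := qh.
have mh := cts_measurable ch.
have [H HE] := dist1_Lspace1 mu mh h01.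
have i0 : (0 : R) < i.+1%:R^-1 by rewrite invr_gt0.
have [d Dd Hd] := Ddense H _ i0.
have {Hd} hd : (dist1 mu h d < (i.+1%:R^-1)%:E)%E.
  by rewrite -HE//; exact: Lspace1_measurable.
(* [h] shows that [q] approximates [d], so a fixed pair below [p] does as well, through some [a]. *)
have [|x [a [Dx fx fa a01 xa]]] := (cP (pickle (f d, i))).2 (f d) i (pickleK _).
  by exists q => //; exists d, h; split => //; rewrite dist1C.
have xd : x = d by apply: finj; rewrite ?inE.
have pa : factors p.1 a by exact: factors_extends (cp _).1 fa.
have [ca _] := pa.
have qa : factors q.1 a by exact: factors_extends pq pa.
have := he a pa a01; rewrite -LX//; last exact: factors_dist.
have : L (fun x => `|h x - a x|) <= 3 * (e / 4).
  apply: (state_le_dist1 Lmu) => //.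
  apply: (le_lt_trans (dist1_triangle mu mh (Lspace1_measurable d) (cts_measurable ca))).
  rewrite (splitr (e / 4 * (e / 4))) EFinD; apply: lteD.
    by apply: (lt_trans hd); rewrite lte_fin.
  by rewrite -xd; apply: (lt_trans xa); rewrite lte_fin.
lra.
Qed.

End maharam_type.

(** * The dichotomy by countable cofinality of a maximal chain *)

Theorem corollary3p7 (R : realType) (K : ptopologicalType)
    (K_compact : compact [set: K]) (K_hausdorff : hausdorff_space K)
    (K_not_scattered : ~ scattered K) :
  (exists mu : probability (borel K) R,
     [/\ radon mu, nonatomic mu & strongly_countably_determined mu]) \/
  (exists mu : probability (borel K) R,
     radon mu /\ uncountable_maharam_type mu).
Proof.
have [A [A0 Aiso]] : exists A : set K, A !=set0 /\ ~ (isolated A !=set0).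
  apply: contrapT => noA; apply: K_not_scattered => A A0.
  by apply: contrapT => Aiso; apply: noA; exists A.
have [g [L0 [g01 sL0 gL0]]] := @exists_diffuse_state R K K_compact K_hausdorff A A0 Aiso.
have [|X [cX X0 Xmax]] := @maximal_chain R K (g, L0); first by split.
have [[c [Xc cof]]|nocof] := pselect (exists c : nat -> node R K,
    (forall k, X (c k)) /\ forall p, X p -> exists k, p = c k \/ below p (c k)).
  left; have [t [tgood tmax]] := maximal_node K_compact cX Xmax Xc cof.
  have [_ st dt] := tgood.
  have [mu tmu] := riesz_markov K_compact K_hausdorff st.
  exists mu; split; first by case: tmu.
    exact: nonatomic_of_diffuse tmu dt.
  exact: maximal_strongly_countably_determined tgood tmax tmu.
right; have [L [sL LX]] := chain_state K_compact cX X0.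
have [mu Lmu] := riesz_markov K_compact K_hausdorff sL.
exists mu; split; first by case: Lmu.
apply: uncountable_maharam_typeP; apply: (chain_uncountable cX _ sL LX Lmu X0).
(* In a chain, a sequence with no member above all its terms is cofinal. *)
move=> c Xc; apply: contrapT => nop; apply: nocof; exists c; split => // p Xp.
apply: contrapT => nok; apply: nop; exists p => // k.
have [_ /(_ _ _ Xp (Xc k))[pc|pc|//]] := cX; exfalso; apply: nok; exists k.
  by left.
by right.
Qed.
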